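(* For all integers $p\geq 4$ and $k\geq p-2$, we have $g^k_{p-2}(p)=k+2$.
   Context: A Gallai-$k$-coloring of the complete graph $K_n$ is a map $c:E(K_n)\to\{1,\dots,k\}$ (not necessarily surjective) with no rainbow triangle, i.e. every triangle receives at most two distinct colors. For integers $k\ge 1$ and $1\le q\le \binom{p}{2}$, $g^k_q(p)$ denotes the smallest positive integer $n$ such that every Gallai-$k$-coloring of $K_n$ contains a copy of $K_p$ whose edges receive at most $q$ distinct colors. *)

(* Defs.v *)
From HB Require Import structures.
From mathcomp Require Import all_boot.

Set Implicit Arguments.
Unset Strict Implicit.
Unset Printing Implicit Defensive.

(* The edges of the complete graph K_n on the vertex set 'I_n. *)
Definition edge (n : nat) := {e : {set 'I_n} | #|e| == 2}.

(* Colors are numbered 0, ..., k-1 instead of 1, ..., k; not all of them need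
   be used. *)
Definition coloring (n k : nat) := {ffun edge n -> 'I_k}.

Definition clique_colors (n k : nat) (c : coloring n k) (S : {set 'I_n}) :
    {set 'I_k} :=
  [set c e | e : edge n & val e \subset S].

Definition gallai (n k : nat) (c : coloring n k) : Prop :=
  forall T : {set 'I_n}, #|T| = 3 -> #|clique_colors c T| <= 2.

Definition gallai_arrow (k q p n : nat) : Prop :=
  forall c : coloring n k, gallai c ->
    exists S : {set 'I_n}, #|S| = p /\ #|clique_colors c S| <= q.

(* "g^k_q(p) = n"; g is given by its graph, so that stating its value includes
   that the minimum exists. *)
Definition is_gallai_number (k q p n : nat) : Prop :=
  [/\ 0 < n, gallai_arrow k q p n
    & forall m : nat, 0 < m -> gallai_arrow k q p m -> n <= m].

(* Main.v *)
Require Import Defs.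
From HB Require Import structures.
From mathcomp Require Import all_boot.

(** Let n be the number of vertices.

    Upper bound. In a Gallai coloring, adding one vertex to a clique adds at
    most one color: two new colors on edges vx and vy would make the triangle
    vxy rainbow, the color of xy being an old one ([clique_colors_setU1]).  So
    a clique whose number of colors is at most its size minus 2 can be enlarged
    one vertex at a time without losing that property
    ([few_colors_extension]), and it is enough to find a K_4 with at most two
    colors.

    Suppose that there is none.  Then no triangle is monochromatic, so every
    triangle has exactly two colors and singles out the vertex where its two
    edges of equal color meet, as for three leaves of a rooted binary tree.
    The key point is that this tree has a cherry: two vertices v and w that
    every other vertex sees in the same color ([cherry_exists]).  The color of
    a cherry vw occurs on no edge avoiding v, since otherwise it would lead to
    a K_4 with two colors.  Deleting v therefore loses a color, and by induction
    n vertices carry at least n - 1 colors ([many_colors]).  With n = k + 2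
    this is more than the k colors available.

    Lower bound. On at most k + 1 vertices, color the edge uv with
    max(u, v) - 1.  A set of s > 0 vertices then carries exactly s - 1 colors,
    one for each vertex but the smallest ([max_coloring_colors]): triangles
    have two colors and copies of K_p have p - 1. *)

Set Implicit Arguments.
Unset Strict Implicit.
Unset Printing Implicit Defensive.

(** * Colors of pairs of vertices *)

(** With the value [None] on the diagonal, the statements about triangles below
    hold for all triples of vertices, distinct or not. *)
Definition pair_color (n k : nat) (c : coloring n k) (u v : 'I_n) :
    option 'I_k :=
  omap c (insub [set u; v]).

Lemma pair_colorC n k (c : coloring n k) u v :
  pair_color c u v = pair_color c v u.
Proof. by rewrite /pair_color setUC. Qed.

Lemma pair_color_diag n k (c : coloring n k) u : pair_color c u u = None.
Proof. by rewrite /pair_color insubN // setUid cards1. Qed.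

Lemma pair_color_neq n k (c : coloring n k) u v :
  u != v -> exists a, pair_color c u v = Some a.
Proof.
move=> uv; have e2 : #|[set u; v]| == 2 by rewrite cards2 uv.
by exists (c (Sub [set u; v] e2)); rewrite /pair_color insubT.
Qed.

Lemma clique_colorsP n k (c : coloring n k) (S : {set 'I_n}) a :
  reflect (exists u v, [/\ u \in S, v \in S & pair_color c u v = Some a])
          (a \in clique_colors c S).
Proof.
apply: (iffP imsetP) => [[e eS ->]|[u [v [uS vS]]]].
  case/cards2P: (valP e) => u [v [uv euv]]; exists u, v.
  move: eS; rewrite inE euv subUset !sub1set => /andP[-> ->]; split=> //.
  by rewrite /pair_color -euv valK.
rewrite /pair_color; case: insubP => //= e _ ve [<-].
by exists e; rewrite // inE ve subUset !sub1set uS vS.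
Qed.

Lemma clique_colorsS n k (c : coloring n k) (S T : {set 'I_n}) :
  S \subset T -> clique_colors c S \subset clique_colors c T.
Proof.
move=> /subsetP ST; apply/subsetP => a /clique_colorsP[u [v [uS vS uva]]].
by apply/clique_colorsP; exists u, v; split; rewrite ?ST.
Qed.

Lemma clique_colors_le2 n k (c : coloring n k) (S : {set 'I_n}) o1 o2 :
  {in S &, forall u v, u != v -> pair_color c u v \in [:: o1; o2]} ->
  #|clique_colors c S| <= 2.
Proof.
move=> S12; rewrite -(card_imset _ (@Some_inj _)).
have /subset_leq_card/leq_trans-> // :
    Some @: clique_colors c S \subset [set o1; o2].
  apply/subsetP => _ /imsetP[a /clique_colorsP[u [v [uS vS uva]]] ->].
  have uv : u != v by apply/eqP => uv; move: uva; rewrite uv pair_color_diag.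
  by rewrite -uva; move: (S12 u v uS vS uv); rewrite !inE.
by rewrite cards2; case: eqP.
Qed.

Lemma no_rainbow n k (c : coloring n k) : gallai c -> forall u v w,
  [\/ pair_color c u v = pair_color c u w,
      pair_color c u v = pair_color c v w
    | pair_color c u w = pair_color c v w].
Proof.
move=> gc u v w.
have [->|uv] := eqVneq u v; first by constructor 3.
have [->|uw] := eqVneq u w; first by constructor 2; rewrite pair_colorC.
have [->|vw] := eqVneq v w; first by constructor 1.
have [a uva] := pair_color_neq c uv.
have [b uwb] := pair_color_neq c uw.
have [d vwd] := pair_color_neq c vw.
rewrite uva uwb vwd.
have [->|ab] := eqVneq a b; first by constructor 1.
have [->|ad] := eqVneq a d; first by constructor 2.
have [->|bd] := eqVneq b d; first by constructor 3.
have T3 : #|[set u; v; w]| = 3.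
  by rewrite -setUA cardsU1 !inE negb_or uv uw cards2 vw.
have := gc _ T3; rewrite leqNgt => /negP[].
have <- : #|[set a; b; d]| = 3.
  by rewrite -setUA cardsU1 !inE negb_or ab ad cards2 bd.
apply/subset_leq_card/subsetP => x; rewrite !inE => /orP[/orP[]|] /eqP->;
  apply/clique_colorsP.
- by exists u, v; rewrite !inE !eqxx ?orbT.
- by exists u, w; rewrite !inE !eqxx ?orbT.
- by exists v, w; rewrite !inE !eqxx ?orbT.
Qed.

(** * Enlarging a clique with few colors *)

(** Two distinct new colors on edges vx and vy would make vxy rainbow. *)
Lemma clique_colors_setU1 n k (c : coloring n k) v (S : {set 'I_n}) :
  gallai c -> #|clique_colors c (v |: S)| <= #|clique_colors c S|.+1.
Proof.
move=> gc; rewrite -(cardsID (clique_colors c S) (clique_colors c (v |: S))).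
rewrite -addn1 leq_add ?subset_leq_card ?subsetIr //.
have new a : a \in clique_colors c (v |: S) :\: clique_colors c S ->
    exists2 x, x \in S & pair_color c v x = Some a.
  rewrite inE => /andP[aS /clique_colorsP[x [y []]]].
  rewrite !inE => /predU1P[->|xS] /predU1P[->|yS].
  - by rewrite pair_color_diag.
  - by exists y.
  - by rewrite pair_colorC; exists x.
  - by move=> xya; case/negP: aS; apply/clique_colorsP; exists x, y.
apply/card_le1_eqP => a b Da Db.
have [x xS vxa] := new _ Da; have [y yS vyb] := new _ Db.
move: Da Db; rewrite !inE => /andP[aS _] /andP[bS _].
have := no_rainbow gc v x y; rewrite vxa vyb => -[[//]|E|E].
  by case/negP: aS; apply/clique_colorsP; exists x, y.
by case/negP: bS; apply/clique_colorsP; exists x, y.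
Qed.

Lemma few_colors_extension n k (c : coloring n k) s p (S : {set 'I_n}) :
    gallai c -> #|S| = s -> s <= p <= n -> #|clique_colors c S| + 2 <= s ->
  exists T : {set 'I_n}, #|T| = p /\ #|clique_colors c T| + 2 <= p.
Proof.
move=> gc Ss /andP[sp pn] cS; rewrite -(subnKC sp) in pn *.
elim: (p - s) pn => [|d IHd] dn; first by exists S; rewrite addn0.
rewrite addnS in dn *; have [T [Td cT]] := IHd (ltnW dn).
have /card_gt0P[v] : 0 < #|~: T|.
  by have := cardsC T; rewrite card_ord Td; case: #|~: T| dn => //;
     rewrite addn0 => + E; rewrite E ltnn.
rewrite inE => vT; exists (v |: T); rewrite cardsU1 vT Td; split=> //.
by apply: leq_trans (_ : (#|clique_colors c T| + 2).+1 <= _) => //;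
   rewrite -addSn leq_add2r clique_colors_setU1.
Qed.

(** * Colorings in which every K_4 has at least three colors *)

Definition no_2colored_K4 (n k : nat) (c : coloring n k) : Prop :=
  forall S : {set 'I_n}, #|S| = 4 -> 2 < #|clique_colors c S|.

Lemma no_2colored_K4P n k (c : coloring n k) u v w x o1 o2 :
    no_2colored_K4 c -> uniq [:: u; v; w; x] ->
  ~ [/\ pair_color c u v \in [:: o1; o2], pair_color c u w \in [:: o1; o2],
        pair_color c u x \in [:: o1; o2] &
     [/\ pair_color c v w \in [:: o1; o2], pair_color c v x \in [:: o1; o2] &
        pair_color c w x \in [:: o1; o2]]].
Proof.
move=> c4 U [uv uw ux [vw vx wx]].
have := c4 [set y in [:: u; v; w; x]]; rewrite cardsE (card_uniqP U).
move=> /(_ erefl); rewrite ltnNge => /negP[].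
apply: (@clique_colors_le2 _ _ _ _ o1 o2) => y z.
rewrite !inE in uv uw ux vw vx wx *.
by move=> /or4P[] /eqP-> /or4P[] /eqP->; rewrite ?eqxx // pair_colorC.
Qed.

(** A fourth vertex sees a monochromatic triangle in at most one color other
    than that of the triangle, so the two together would span a 2-colored
    K_4. *)
Lemma no_mono_triangle n k (c : coloring n k) u v w :
    gallai c -> no_2colored_K4 c -> 3 < n -> uniq [:: u; v; w] ->
  ~ (pair_color c u v = pair_color c u w /\
     pair_color c u v = pair_color c v w).
Proof.
move=> gc c4 n4 U [uvw vuw].
have /card_gt0P[x] : 0 < #|~: [set y in [:: u; v; w]]|.
  have := cardsC [set y in [:: u; v; w]].
  rewrite cardsE (card_uniqP U) card_ord /=.
  by case: #|_| => // E; rewrite -E in n4.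
rewrite !in_set => xU; have U4 : uniq [:: x; u; v; w] by rewrite cons_uniq xU.
have := no_rainbow gc x u v; have := no_rainbow gc x u w.
have := no_rainbow gc x v w; rewrite -vuw -uvw => xvw xuw xuv.
have := @no_2colored_K4P _ _ c x u v w (pair_color c u v) _ c4 U4.
rewrite -vuw -uvw => no2.
have [xu|xu] := eqVneq (pair_color c x u) (pair_color c u v).
  have [xv|xv] := eqVneq (pair_color c x v) (pair_color c u v).
    by case: (no2 (pair_color c x w)); rewrite xu xv !inE !eqxx ?orbT.
  case: (no2 (pair_color c x v)); rewrite xu !inE !eqxx ?orbT; split=> //.
  by case: xvw => [<-|/eqP|->]; rewrite ?eqxx ?orbT ?(negPf xv).
case: (no2 (pair_color c x u)); rewrite !inE !eqxx ?orbT; split=> //.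
  by case: xuv => [<-|/eqP|->]; rewrite ?eqxx ?orbT ?(negPf xu).
by case: xuw => [<-|/eqP|->]; rewrite ?eqxx ?orbT ?(negPf xu).
Qed.

(** If v is the odd vertex of the triangle uvw, then in the tree picture u and w
    are closer to each other than v and w, so a vertex x that does not tell v
    from w does not tell u from w either. *)
Lemma closer_pair n k (c : coloring n k) (u v w x : 'I_n) :
    gallai c -> no_2colored_K4 c -> 3 < n -> uniq [:: u; v; w] ->
    pair_color c v u = pair_color c v w ->
    pair_color c x v = pair_color c x w ->
  pair_color c x u = pair_color c x w.
Proof.
move=> gc c4 n4 U vuw xvw.
have [xv|xv] := eqVneq x v; first by rewrite xv.
have [xu|xu] := eqVneq x u.
  subst x; case: (@no_mono_triangle _ _ c u v w gc c4 n4 U).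
  by split; rewrite // pair_colorC.
have [xw|xw] := eqVneq x w.
  subst x; have [a] := pair_color_neq c xv.
  by rewrite xvw pair_color_diag.
have U4 : uniq [:: x; u; v; w] by rewrite cons_uniq !inE !negb_or xu xv xw.
have Uxvw : uniq [:: x; v; w].
  move: U4; rewrite /= !inE !negb_or -!andbA.
  by move=> /and5P[_ -> -> _ /and3P[_ ->]].
have xvNvw : pair_color c x v <> pair_color c v w.
  by move=> E; case: (no_mono_triangle gc c4 n4 Uxvw).
case: (no_rainbow gc x u v) => [->//|xuE|]; last first.
  by rewrite (pair_colorC c u v) vuw.
rewrite (pair_colorC c u v) vuw in xuE.
case: (no_rainbow gc x u w) => [//|xuw|xwu].
  by case: (no_mono_triangle gc c4 n4 U);
     rewrite (pair_colorC c u v) vuw -xuE xuw.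
(* What is left is a K_4 with only the colors of vw and xw. *)
have := @no_2colored_K4P _ _ c x u v w (pair_color c v w) (pair_color c x w).
case/(_ c4 U4).
by rewrite xuE xvw (pair_colorC c u v) vuw -xwu !inE !eqxx ?orbT.
Qed.

(** Choose the pair v, w that the largest number of vertices of X do not tell
    apart.  If some u does tell v from w, then uw or uv is a better pair. *)
Lemma cherry_exists n k (c : coloring n k) (X : {set 'I_n}) :
    gallai c -> no_2colored_K4 c -> 3 < n -> 1 < #|X| ->
  exists v w, [/\ v \in X, w \in X, v != w &
    {in X, forall u, u != v -> u != w -> pair_color c u v = pair_color c u w}].
Proof.
move=> gc c4 n4 /card_gt1P[v0 [w0 [v0X w0X vw0]]].
pose N v w := [set u in X | pair_color c u v == pair_color c u w].
pose P (q : 'I_n * 'I_n) := [&& q.1 \in X, q.2 \in X & q.1 != q.2].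
have P0 : P (v0, w0) by rewrite /P v0X w0X vw0.
case: (@arg_maxnP _ (v0, w0) P (fun q => #|N q.1 q.2|) P0) => -[v w] /=.
case/and3P=> /= vX wX vw maxN; exists v, w; split=> // u uX uv uw.
apply/eqP/negPn/negP => /eqP uvw.
have better y z : y \in X -> z \in X -> uniq [:: u; y; z] ->
    pair_color c y u = pair_color c y z -> #|N y z| < #|N u z|.
  move=> yX zX U yuz; apply: proper_card; apply/properP; split.
    apply/subsetP => x; rewrite !in_set => /andP[-> /eqP xyz] /=.
    by apply/eqP; apply: (closer_pair gc c4 n4 U).
  exists y; rewrite !in_set yX ?yuz ?eqxx //= pair_color_diag eq_sym.
  have [|a ->] // := @pair_color_neq _ _ c y z.
  by move: U => /and3P[_]; rewrite inE.
have NC : N w v = N v w by apply/setP => x; rewrite !in_set eq_sym.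
case: (no_rainbow gc u v w) => [//|E|E].
  have := maxN (u, w); rewrite /P /= uX wX uw => /(_ isT).
  rewrite /= leqNgt => /negP[]; apply: better => //.
    by rewrite /= !inE negb_or uv uw vw.
  by rewrite pair_colorC.
have := maxN (u, v); rewrite /P /= uX vX uv => /(_ isT).
rewrite /= leqNgt -NC => /negP[]; apply: better => //.
  by rewrite /= !inE negb_or uv uw eq_sym vw.
by rewrite pair_colorC E pair_colorC.
Qed.

(** Deleting the vertex v of a cherry vw loses the color of vw: another edge of
    this color would form a monochromatic triangle with vw if it contains w, and
    a 2-colored K_4 if it is disjoint from vw. *)
Lemma many_colors n k (c : coloring n k) (X : {set 'I_n}) :
  gallai c -> no_2colored_K4 c -> 3 < n -> #|X| <= #|clique_colors c X|.+1.
Proof.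
move=> gc c4 n4; move: {2}#|X| (leqnn #|X|) => m.
elim: m X => [|m IHm] X; first by rewrite leqn0 => /eqP->.
move=> Xm; have [X1|X2] := leqP #|X| 1; first exact: leq_trans X1 _.
have [v [w [vX wX vw cherry]]] := cherry_exists gc c4 n4 X2.
have [a vwa] := pair_color_neq c vw.
have cvX : #|X :\ v| <= #|clique_colors c (X :\ v)|.+1.
  by apply: IHm; rewrite (cardsD1 v) vX in Xm.
rewrite (cardsD1 v) vX add1n ltnS; apply: leq_trans cvX _.
apply: proper_card; apply/properP; split.
  by apply: clique_colorsS; rewrite subD1set.
exists a; first by apply/clique_colorsP; exists v, w.
have aNw y : y \in X -> y != v -> pair_color c w y <> Some a.
  move=> yX yv wya; have [yw|yw] := eqVneq y w.
    by move: wya; rewrite yw pair_color_diag.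
  case: (@no_mono_triangle _ _ c v w y gc c4 n4).
    by rewrite /= !inE negb_or vw !(eq_sym _ y) yv yw.
  rewrite wya vwa; split=> //.
  by rewrite pair_colorC (cherry y) // pair_colorC wya.
apply/negP => /clique_colorsP[x [y []]].
rewrite !in_setD1 => /andP[xv xX] /andP[yv yX] xya.
have [xw|xw] := eqVneq x w; first by apply: (aNw y) => //; rewrite -xw.
have [yw|yw] := eqVneq y w.
  by apply: (aNw x) => //; rewrite -yw pair_colorC.
have xy : x != y by apply/eqP => xy; move: xya; rewrite xy pair_color_diag.
have U : uniq [:: x; y; v; w] by rewrite /= !inE !negb_or xy xv xw yv yw vw.
have := @no_2colored_K4P _ _ c x y v w (Some a) _ c4 U.
rewrite xya vwa -(cherry x) // -(cherry y) //.
have := no_rainbow gc x y v; rewrite xya => -[E|E|E] no2.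
- by case: (no2 (pair_color c y v)); rewrite -E !inE !eqxx ?orbT.
- by case: (no2 (pair_color c x v)); rewrite -E !inE !eqxx ?orbT.
- by case: (no2 (pair_color c x v)); rewrite -E !inE !eqxx ?orbT.
Qed.

(** * The extremal coloring *)

Definition max_coloring (m k : nat) : coloring m k.+1 :=
  [ffun e : edge m => inord (\max_(i in val e) (i : nat)).-1].

Lemma max_coloringE m k (u v : 'I_m) :
  u < v -> pair_color (max_coloring m k) u v = Some (inord v.-1).
Proof.
move=> uv; have nuv : u != v by rewrite neq_ltn uv.
have [a] := pair_color_neq (max_coloring m k) nuv.
rewrite /pair_color; case: insubP => //= e _ ve _.
rewrite ffunE /= ve big_setU1 ?inE // big_set1 /=.
by rewrite (maxn_idPr (ltnW uv) : maxn u v = v).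
Qed.

(** The colors of S are the numbers v - 1 for the vertices v of S other than
    its minimum: v - 1 is the color of the edge joining v to the minimum. *)
Lemma max_coloring_colors m k (S : {set 'I_m}) :
  m <= k.+2 -> 0 < #|S| -> #|clique_colors (max_coloring m k) S| = #|S|.-1.
Proof.
move=> mk /card_gt0P[x xS].
case: (@arg_minnP _ x (fun i => i \in S) (fun i => i : nat) xS) => z zS minz.
have lt_z v : v \in S :\ z -> z < v.
  by rewrite in_setD1 => /andP[vz vS]; rewrite ltn_neqAle eq_sym vz minz.
have -> : clique_colors (max_coloring m k) S
          = [set inord (val v).-1 | v in S :\ z].
  apply/setP => a; apply/clique_colorsP/imsetP; last first.
    case=> v vSz ->; exists z, v; rewrite max_coloringE ?lt_z //.
    by move: vSz; rewrite in_setD1 => /andP[_ vS].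
  have wlt u v : u \in S -> v \in S -> u < v ->
      pair_color (max_coloring m k) u v = Some a ->
      exists2 v, v \in S :\ z & a = inord (val v).-1.
    move=> uS vS uv; rewrite max_coloringE // => -[<-]; exists v => //.
    by rewrite in_setD1 vS neq_ltn (leq_ltn_trans (minz u uS) uv) orbT.
  case=> u [v [uS vS uva]]; case: (ltngtP u v) => [uv|vu|/val_inj uv].
  - exact: (wlt u v).
  - by apply: (wlt v u); rewrite // pair_colorC.
  - by move: uva; rewrite uv pair_color_diag.
rewrite card_in_imset; first by rewrite [in RHS](cardsD1 z) zS.
move=> u v /lt_z zu /lt_z zv /(congr1 val) /=.
have bound (y : 'I_m) : z < y -> y.-1 < k.+1.
  by move=> zy; rewrite -ltnS (ltn_predK zy) (leq_trans (ltn_ord y)).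
rewrite !inordK ?bound // => /(congr1 succn).
by rewrite (ltn_predK zu) (ltn_predK zv) => /val_inj.
Qed.

(** * The Gallai-Ramsey number *)

Theorem theorem1p8 (p k : nat) (hp : 4 <= p) (hk : p - 2 <= k) :
  is_gallai_number k (p - 2) p (k + 2).
Proof.
have p2 : 2 <= p by apply: leq_trans hp.
have pk : p <= k + 2 by rewrite addnC -leq_subLR.
split; first by rewrite addn2.
- move=> c gc.
  case: (boolP [exists S : {set 'I_(k + 2)},
                  (#|S| == 4) && (#|clique_colors c S| <= 2)]).
    case/existsP => S /andP[/eqP S4 cS].
    have [||T [Tp cT]] := @few_colors_extension _ _ c 4 p S gc S4.
    + by rewrite hp.
    + by rewrite -(leq_add2r 2) in cS.
    by exists T; split=> //; rewrite -(leq_add2r 2) subnK.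
  rewrite negb_exists => /forallP no4.
  have c4 : no_2colored_K4 c.
    by move=> S S4; have := no4 S; rewrite S4 /= -ltnNge.
  have ck : #|clique_colors c [set: _]| <= k.
    by apply: leq_trans (max_card _) _; rewrite card_ord.
  have := many_colors [set: _] gc c4 (leq_trans hp pk).
  rewrite cardsT card_ord => /leq_trans/(_ (ck : _ < k.+1)).
  by rewrite leqNgt [X in _ < X]addn2 ltnSn.
- move=> m _ arrow; rewrite leqNgt addn2; apply/negP; rewrite ltnS => mk.
  case: k hk {pk} arrow mk => [|k] hk arrow mk.
    by move: hk; rewrite leqNgt subn_gt0 (leq_trans _ hp).
  have [|S [Sp]] := arrow (max_coloring m k).
    by move=> T T3; rewrite max_coloring_colors ?T3.
  by rewrite max_coloring_colors ?Sp ?(ltnW p2) // leqNgt -subn1 ltn_sub2l.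
Qed.
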